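(* Let $r\ge1$ and let $b_1\ge\cdots\ge b_r$ be integers with $b_i\ge i$ for all $i$. Let $M=b_1-1$ and let $\mathbf u=(u_1,\dots,u_M)$ be commuting indeterminates. The multivariate descent enumerator $$\mathcal D_{\mathbf b}(\mathbf u)=\sum_{w\in\mathcal W_{\mathbf b}}\prod_{j\in D(w)}u_j$$ is coefficientwise positive (nonnegative integer coefficients), and the $q$-Zeta numerator of the Ferrers-cell poset $F_{\mathbf b}$ is its principal specialization $$\mathbb{H}_{F_{\mathbf b},\rho}(q,t)=\mathcal D_{\mathbf b}(t,tq,tq^2,\dots,tq^{M-1}).$$ More generally, for an interval $I=[x,y]$ of $F_{\mathbf b}$ of length $h\ge1$, with $x=(i,c)<y=(j,d)$ and $h=(i-j)+(d-c)$, the local descent enumerator $$\mathcal D_I(\mathbf u)=\sum_{w\in\mathcal W_{\mathbf b}(x,y)}\ \prod_{p\in D_{x,y}(w)}u_p$$ in the variables $u_1,\dots,u_{h-1}$ specializes to $$\mathbb{H}_{I,\rho_{x,y}}(q,t)=\mathcal D_I(tq,tq^2,\dots,tq^{h-1}),$$ where $\rho_{x,y}(z)=\rho(z)-\rho(x)$.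
   Context: $q$-Zeta numerator: let $P$ be a finite graded poset with a unique maximum and rank function $\rho:P\to\{0,\dots,H\}$, where $H$ is the maximal rank. For $m\ge 0$ put $A_m(P,\rho;q)=\sum_{x_1\le\cdots\le x_m}q^{\rho(x_1)+\cdots+\rho(x_m)}$ (sum over weak chains in $P$; $A_0=1$). The numerator $\mathbb{H}_{P,\rho}(q,t)$ is the polynomial determined by $\sum_{m\ge 0}A_m(P,\rho;q)t^m=\mathbb{H}_{P,\rho}(q,t)/\prod_{a=0}^{H}(1-q^at)$. Ferrers-cell poset: $F_{\mathbf b}=\{(i,c):1\le i\le r,\ i\le c\le b_i\}$, ordered by $(i,c)\le(j,d)\iff i\ge j$ and $c\le d$, with rank $\rho(i,c)=c-i$. Global words: for $w\in\{L,R\}^M$ let $\ell(w)$ be its number of $L$'s and $\iota(w)=\ell(w)+1$. $\mathcal W_{\mathbf b}$ is the set of $w\in\{L,R\}^M$ with $\ell(w)\le r-1$ such that for every prefix, with $L_k$ letters $L$ and $R_k$ letters $R$, $\iota(w)+R_k\le b_{\iota(w)-L_k}$. $D(w)=\{j: w_j=L\text{ and }(j=1\text{ or }w_{j-1}=R)\}$. Local words: $\mathcal W_{\mathbf b}(x,y)$ is the set of words with exactly $i-j$ letters $L$ and $d-c$ letters $R$ such that every prefix with $L_k$ letters $L$ and $R_k$ letters $R$ satisfies $c+R_k\le b_{i-L_k}$; $D_{x,y}(w)=\{p\in\{1,\dots,h-1\}:w_p=R,\ w_{p+1}=L\}$. *)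

(* Defs.v *)
From HB Require Import structures.
From mathcomp Require Import all_boot all_order all_algebra.
From mathcomp Require Import mpoly.

Set Implicit Arguments.
Unset Strict Implicit.
Unset Printing Implicit Defensive.

Import Order.TTheory GRing.Theory.
Local Open Scope ring_scope.

(* Polynomials in q and t are elements of {poly {poly int}}: q is the inner
   variable and t the outer one. *)
Definition qvar : {poly {poly int}} := 'X%:P.
Definition tvar : {poly {poly int}} := 'X.

Section QZeta.
Variables (disp : Order.disp_t) (T : finPOrderType disp).
(* P carries the order induced from T, so that a poset and its intervals are
   treated alike. *)
Variables (P : {set T}) (rho : T -> nat).

Definition is_chain (m : nat) (x : m.-tuple T) : bool :=
  all (mem P) x && sorted <=%O x.

Definition qzeta_coef (m : nat) : {poly int} :=
  \sum_(x : m.-tuple T | is_chain x) 'X^(\sum_(k < m) rho (tnth x k)).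

Definition max_rank : nat := \max_(z in P) rho z.

Definition qzeta_denominator : {poly {poly int}} :=
  \prod_(a < max_rank.+1) (1 - qvar ^+ a * tvar).

(* N = denominator * \sum_m qzeta_coef m * t^m as formal power series in t,
   that is, coefficient by coefficient. *)
Definition is_qzeta_numerator (N : {poly {poly int}}) : Prop :=
  forall n : nat,
    N`_n = \sum_(k < n.+1) qzeta_denominator`_k * qzeta_coef (n - k).

Lemma qzeta_numerator_unique (N1 N2 : {poly {poly int}}) :
  is_qzeta_numerator N1 -> is_qzeta_numerator N2 -> N1 = N2.
Proof. by move=> h1 h2; apply/polyP => n; rewrite h1 h2. Qed.

End QZeta.

(* The entries b 1, ..., b r are the given integers; other values of b play no
   role.  For nonincreasing b every cell has column at most b 1, so the range of
   the second coordinate is no restriction. *)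
Definition is_cell (r : nat) (b : nat -> nat)
    (z : 'I_r.+1 * 'I_(b 1%N).+1) : bool :=
  (1 <= z.1)%N && (z.1 <= z.2 <= b z.1)%N.

Record ferrers (r : nat) (b : nat -> nat) : Type := Cell {
  cell_val : 'I_r.+1 * 'I_(b 1%N).+1;
  _ : is_cell cell_val
}.

HB.instance Definition _ r b := [isSub for @cell_val r b].
HB.instance Definition _ r b := [Finite of ferrers r b by <:].

Section FerrersOrder.
Variables (r : nat) (b : nat -> nat).
Implicit Types x y z : ferrers r b.

Definition cell_row x : nat := (cell_val x).1.
Definition cell_col x : nat := (cell_val x).2.

Definition ferrers_le x y : bool :=
  (cell_row y <= cell_row x)%N && (cell_col x <= cell_col y)%N.

Fact ferrers_le_refl : reflexive ferrers_le.
Proof. by move=> x; rewrite /ferrers_le !leqnn. Qed.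

Fact ferrers_le_anti : antisymmetric ferrers_le.
Proof.
move=> x y /andP[/andP[h1 h2] /andP[h3 h4]]; apply: val_inj => /=.
rewrite (surjective_pairing (cell_val x)) (surjective_pairing (cell_val y)).
by congr (_, _); apply: val_inj; apply/eqP; rewrite eqn_leq; apply/andP.
Qed.

Fact ferrers_le_trans : transitive ferrers_le.
Proof.
move=> y x z /andP[h1 h2] /andP[h3 h4].
by rewrite /ferrers_le (leq_trans h3 h1) (leq_trans h2 h4).
Qed.

End FerrersOrder.

Fact ferrers_display : Order.disp_t. Proof. exact: Order.Disp tt tt. Qed.

HB.instance Definition _ r b :=
  Order.Le_isPOrder.Build ferrers_display (ferrers r b)
    (@ferrers_le_refl r b) (@ferrers_le_anti r b) (@ferrers_le_trans r b).

Definition ferrers_rank r b (z : ferrers r b) : nat :=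
  (cell_col z - cell_row z)%N.

Definition ferrers_interval r b (x y : ferrers r b) : {set ferrers r b} :=
  [set z | (x <= z <= y)%O].

Definition interval_length r b (x y : ferrers r b) : nat :=
  ((cell_row x - cell_row y) + (cell_col y - cell_col x))%N.

Definition local_rank r b (x z : ferrers r b) : nat :=
  (ferrers_rank z - ferrers_rank x)%N.

Notation letter := bool (only parsing).
Definition stepL : letter := true.
Definition stepR : letter := false.

(* The path that starts at (i, c) and follows w, a letter L decreasing the row
   by one and a letter R increasing the column by one, satisfies the upper
   bound on the column after every prefix of w. *)
Definition prefix_ok (b : nat -> nat) (i c : nat) (w : seq letter) : bool :=
  [forall k : 'I_(size w).+1,
     (c + count_mem stepR (take k w) <=
      b (i - count_mem stepL (take k w)))%N].

Section GlobalWords.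
Variables (r : nat) (b : nat -> nat).

Definition word_length : nat := (b 1%N - 1)%N.

Definition iota_word (w : seq letter) : nat := (count_mem stepL w).+1.

Definition global_words : {set word_length.-tuple letter} :=
  [set w : word_length.-tuple letter |
    (count_mem stepL w <= r - 1)%N &&
    prefix_ok b (iota_word w) (iota_word w) w].

(* The index j stands for the 1-based position j + 1. *)
Definition global_descents (w : word_length.-tuple letter) :
    {set 'I_word_length} :=
  [set j : 'I_word_length |
    (tnth w j == stepL) &&
    ((j == 0 :> nat) || (nth stepL w j.-1 == stepR))].

(* 'X_j is u_(j + 1). *)
Definition global_enum : {mpoly int[word_length]} :=
  \sum_(w in global_words) \prod_(j in global_descents w) 'X_j.

End GlobalWords.

Section LocalWords.
Variables (r : nat) (b : nat -> nat) (x y : ferrers r b).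

Let h := interval_length x y.

Definition local_words : {set h.-tuple letter} :=
  [set w : h.-tuple letter |
    [&& count_mem stepL w == (cell_row x - cell_row y)%N,
        count_mem stepR w == (cell_col y - cell_col x)%N
      & prefix_ok b (cell_row x) (cell_col x) w]].

(* The index p < h - 1 stands for the 1-based position p + 1. *)
Definition local_descents (w : h.-tuple letter) : {set 'I_(h - 1)} :=
  [set p : 'I_(h - 1) |
    (nth stepL w p == stepR) && (nth stepR w p.+1 == stepL)].

(* 'X_p is u_(p + 1). *)
Definition local_enum : {mpoly int[h - 1]} :=
  \sum_(w in local_words) \prod_(p in local_descents w) 'X_p.

End LocalWords.

Definition specialize (n : nat) (v : 'I_n -> {poly {poly int}})
    (D : {mpoly int[n]}) : {poly {poly int}} :=
  mmap intr v D.

(* Main.v *)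
Require Import Defs.
From mathcomp Require Import all_boot all_order all_algebra.
From mathcomp Require Import mpoly.
From mathcomp Require Import ring zify.

(* Fix a top cell y of rank H, put x_a = t q^a, and let G(i,c) be the series of
   weak chains in the cells between (i,c) and y.  Removing the copies of the
   first cell and applying inclusion-exclusion to its two upper covers gives,
   for a cell (i,c) of rank a,
     (1 - x_a) G(i,c) = G(i-1,c) + G(i,c+1) - G(i-1,c+1)
   (the last two terms being absent when c = b_i), so that
   N(i,c) = prod_(a <= e <= H) (1 - x_e) G(i,c) satisfies
     N(i,c) = N(i-1,c) + N(i,c+1) - (1 - x_(a+1)) N(i-1,c+1).
   The descent enumerator of the words from (i,c) to y satisfies the same
   recursion, by splitting on the first letter and, after an R, on whether the
   next letter is L.  For the whole poset, adding the rows one at a time gives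
   sum_k G(k,k) - sum_k G(k-1,k); this matches reading global words as if they
   were preceded by an R, which turns an initial L into a descent.  Power series
   are truncated: identities hold modulo t^(n+1) for every n. *)

Set Implicit Arguments.
Unset Strict Implicit.
Unset Printing Implicit Defensive.

Import Order.TTheory GRing.Theory Num.Theory.
Local Open Scope ring_scope.

(** * Sums over tuples, split at the first entry *)

Lemma big_tuple0 (V : nmodType) (T : finType) (P : pred (seq T))
    (F : seq T -> V) :
  \sum_(w : 0.-tuple T | P w) F w = if P [::] then F [::] else 0.
Proof.
rewrite big_mkcond (bigD1 [tuple]) //= big1 ?addr0 // => w.
by rewrite (tuple0 w) => /negP[].
Qed.

Lemma big_tupleS (V : nmodType) (T : finType) n (P : pred (seq T))
    (F : seq T -> V) :
  \sum_(w : n.+1.-tuple T | P w) F w =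
  \sum_(u : T) \sum_(w : n.-tuple T | P (u :: w)) F (u :: w).
Proof.
pose h (p : T * n.-tuple T) : n.+1.-tuple T := [tuple of p.1 :: p.2].
rewrite pair_big_dep /= (reindex h) //=.
exists (fun w => (thead w, [tuple of behead w])) => [[u w]|w] _ /=.
  by congr pair; apply: val_inj.
by rewrite /h /= -tuple_eta.
Qed.

(** * Lattice-path words and their descent weights *)

Section Words.
Variables (b : nat -> nat).

Lemma prefix_ok_nil i c : prefix_ok b i c [::] = (c <= b i)%N.
Proof.
apply/forallP/idP => [/(_ ord0)|hc k]; rewrite /= ?addn0 ?subn0 //.
Qed.

Lemma prefix_ok_cons i c l w : prefix_ok b i c (l :: w) =
  (c <= b i)%N && prefix_ok b (i - (l == stepL)) (c + (l == stepR)) w.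
Proof.
apply/forallP/andP => [H|[hc /forallP H] k].
  split; first by have := H ord0; rewrite /= addn0 subn0.
  apply/forallP => k; have := H (lift ord0 k).
  by rewrite lift0 /= addnA subnDA.
have := ltn_ord k; case: {k} (val k) => [|k] hk /=.
  by rewrite addn0 subn0.
by rewrite addnA subnDA; apply: (H (Ordinal (hk : (k < (size w).+1)%N))).
Qed.

Variables (R : comNzRingType) (x : nat -> R).

(* [s] is the letter preceding [w], whose first letter starts at rank [a]. *)
Fixpoint descent_weight (s : bool) (a : nat) (w : seq bool) : R :=
  if w is l :: w' then
    (if (s == stepR) && (l == stepL) then x a else 1)
      * descent_weight l a.+1 w'
  else 1.

Lemma descent_weightE s a w : descent_weight s a w =
  \prod_(0 <= k < size w | (nth stepL (s :: w) k == stepR)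
                           && (nth stepL w k == stepL)) x (a + k)%N.
Proof.
rewrite big_mkcond; elim: w s a => [|l w IH] s a /=; first by rewrite big_nil.
rewrite big_nat_recl //= addn0 IH; congr (_ * _).
by apply: eq_bigr => k _; rewrite addSnnS.
Qed.

Variables (j d : nat).

(** Additive equations avoid truncated subtraction: no word qualifies when [i < j] or [d < c]. *)
Definition path_ok (i c : nat) (w : seq bool) : bool :=
  [&& (count_mem stepL w + j == i)%N, (c + count_mem stepR w == d)%N
    & prefix_ok b i c w].

Definition path_sum s a i c n : R :=
  \sum_(w : n.-tuple bool | path_ok i c w) descent_weight s a w.

Lemma path_ok_cons i c l w : path_ok i c (l :: w) =
  (c <= b i)%N &&
  (if l then (0 < i)%N && path_ok i.-1 c w else path_ok i c.+1 w).
Proof.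
rewrite /path_ok prefix_ok_cons; case: l => /=.
  rewrite addn0 subn1 add0n.
  case: i => [|i] /=; last by rewrite -addnA add1n eqSS; do 2 case: eqP; rewrite /= ?andbF.
  by rewrite andbF.
rewrite subn0 addn1 addnA addn1.
by do 2 case: (_ == _); rewrite /= ?andbF.
Qed.

Lemma path_sum0 s a i c :
  path_sum s a i c 0 = ([&& i == j, c == d & (c <= b i)%N])%:R.
Proof.
rewrite /path_sum (big_tuple0 (path_ok i c) (descent_weight s a)).
rewrite /path_ok prefix_ok_nil /= add0n addn0 [j == i]eq_sym.
by case: ifP => // _; rewrite mulr0n.
Qed.

Lemma path_sumS s a i c n :
  path_sum s a i c n.+1 = if (c <= b i)%N then
   (if s == stepR then x a else 1) *
      (if (0 < i)%N then path_sum stepL a.+1 i.-1 c n else 0)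
   + path_sum stepR a.+1 i c.+1 n else 0.
Proof.
rewrite /path_sum (big_tupleS n (path_ok i c) (descent_weight s a)) big_bool /=.
under eq_bigl do rewrite path_ok_cons.
under [X in _ + X]eq_bigl do rewrite path_ok_cons.
case: (c <= b i)%N => /=; last by rewrite !big_pred0 ?addr0.
congr (_ + _); last first.
  by apply: eq_bigr => w _; rewrite andbF mul1r.
case: (0 < i)%N => /=; last by rewrite big_pred0 ?mulr0.
by rewrite big_distrr /=; apply: eq_bigr => w _; rewrite andbT.
Qed.

Lemma path_sum_nil s a i c n : (b i < c)%N -> path_sum s a i c n = 0.
Proof.
rewrite ltnNge => /negbTE hc.
by case: n => [|n]; rewrite ?path_sum0 ?path_sumS hc // !andbF.
Qed.

Lemma path_sum_row_lt s a i c n : (i < j)%N -> path_sum s a i c n = 0.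
Proof.
move=> ij; rewrite /path_sum big1 // => w /and3P[/eqP hw _ _].
by move: ij; rewrite -hw ltnNge leq_addl.
Qed.

Lemma path_sum_col_gt s a i c n : (d < c)%N -> path_sum s a i c n = 0.
Proof.
move=> dc; rewrite /path_sum big1 // => w /and3P[_ /eqP hw _].
by move: dc; rewrite -hw ltnNge leq_addr.
Qed.

(* Only words starting with L see the difference between the two values of the
   preceding letter. *)
Lemma path_sum_prevR a i c n : (0 < i)%N -> (c <= b i)%N ->
  path_sum stepR a i c n = path_sum stepL a i c n +
    (x a - 1) * (if n is n'.+1 then path_sum stepL a.+1 i.-1 c n' else 0).
Proof.
case: n => [|n] i0 hc; first by rewrite !path_sum0 mulr0 addr0.
by rewrite !path_sumS hc i0 /=; ring.
Qed.

Lemma path_sum_rec a i c n : (0 < i)%N -> (c <= b i)%N ->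
  path_sum stepL a i c n.+1 =
  path_sum stepL a.+1 i.-1 c n +
  (if (c < b i)%N then path_sum stepL a.+1 i c.+1 n - (1 - x a.+1) *
    (if n is n'.+1 then path_sum stepL a.+2 i.-1 c.+1 n' else 0) else 0).
Proof.
move=> i0 hc; rewrite path_sumS hc i0 /= mul1r; congr (_ + _).
case: ifPn => hc1.
  (* Trading the R before the tail for an L only affects tails that start with L; an empty tail
     costs nothing. *)
  by rewrite path_sum_prevR //; case: n => [|n]; ring.
by rewrite path_sum_nil // ltnNge.
Qed.

End Words.

Lemma sum_orb (V : zmodType) (I : finType) (P Q : pred I) (F : I -> V) :
  \sum_(u | P u || Q u) F u =
  \sum_(u | P u) F u + \sum_(u | Q u) F u - \sum_(u | P u && Q u) F u.
Proof.
apply/eqP; rewrite eq_sym subr_eq; apply/eqP.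
rewrite !(big_mkcond P) !(big_mkcond Q) (big_mkcond (fun u => P u || Q u)).
rewrite (big_mkcond (fun u => P u && Q u)) -!big_split /=.
apply: eq_bigr => u _.
by case: (P u); case: (Q u); rewrite ?addr0 ?add0r.
Qed.

Definition weight (a : nat) : {poly {poly int}} := tvar * qvar ^+ a.

(** * Weak chains below a fixed top cell *)

Section Chains.
Variables (r : nat) (b : nat -> nat).
Hypothesis b_noninc : forall i j : nat, (1 <= i)%N -> (i <= j)%N ->
  (j <= r)%N -> (b j <= b i)%N.
Implicit Types u z : ferrers r b.

Lemma cellP u :
  [/\ (0 < cell_row u)%N, (cell_row u <= r)%N, (cell_row u <= cell_col u)%N
    & (cell_col u <= b (cell_row u))%N].
Proof.
case: u => -[i c] /= H; rewrite /cell_row /cell_col /=.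
by case/and3P: (H) => /= h1 h2 h3; split=> //; rewrite -ltnS.
Qed.

Lemma ex_cell i c : (0 < i)%N -> (i <= r)%N -> (i <= c)%N -> (c <= b i)%N ->
  exists u : ferrers r b, cell_row u = i /\ cell_col u = c.
Proof.
move=> i0 ir ic cb.
have cb1 : (c < (b 1%N).+1)%N by rewrite ltnS (leq_trans cb) // b_noninc.
have H : is_cell (Ordinal (ir : (i < r.+1)%N), Ordinal cb1).
  by rewrite /is_cell /= i0 ic.
by exists (Cell H).
Qed.

Lemma cell_inj u z :
  cell_row u = cell_row z -> cell_col u = cell_col z -> u = z.
Proof.
move=> hr hc; apply/le_anti; rewrite /Order.le /= /ferrers_le.
by rewrite hr hc !leqnn.
Qed.

(* Ranks are shifted by [k0]: the rank of x for an interval [x, y], and 0 for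
   the whole poset. *)
Variables (y : ferrers r b) (k0 : nat).
Let j := cell_row y.
Let d := cell_col y.

Definition shifted_rank u : nat := (ferrers_rank u - k0)%N.

(** The corner [(i, c)] need not be a cell, since inclusion-exclusion also produces corners outside
    the diagram. *)
Definition in_box i c u : bool :=
  [&& (j <= cell_row u)%N, (cell_row u <= i)%N, (c <= cell_col u)%N
    & (cell_col u <= d)%N].

(* Weak chains in the box; the empty chain is counted only when the box meets
   the quadrant of [y], which makes the recursion below uniform. *)
Fixpoint chain_sum (m i c : nat) : {poly int} :=
  if m is m'.+1 then
    \sum_(u | in_box i c u)
      'X^(shifted_rank u) * chain_sum m' (cell_row u) (cell_col u)
  else ((j <= i)%N && (c <= d)%N)%:R.

Lemma chain_sum_out m i c : (i < j)%N || (d < c)%N -> chain_sum m i c = 0.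
Proof.
move=> out; case: m => [|m] /=.
  by rewrite (_ : _ && _ = false) //; lia.
by rewrite big_pred0 // => u; apply/negbTE; rewrite /in_box; lia.
Qed.

(** As [P] is a box with upper corner [y], the cells of [P] above [u] are exactly the box of [u]. *)
Lemma chain_sum_path (P : {set ferrers r b}) i0 c0 m u :
  (forall z, (z \in P) = in_box i0 c0 z) -> u \in P ->
  \sum_(w : m.-tuple (ferrers r b) | all (mem P) w && path <=%O u w)
     'X^(\sum_(z <- w) shifted_rank z) =
  chain_sum m (cell_row u) (cell_col u).
Proof.
move=> PE; elim: m u => [|m IH] u uP.
  rewrite (big_tuple0 (fun w => all (mem P) w && path <=%O u w)
             (fun w => 'X^(\sum_(z <- w) shifted_rank z))) /= big_nil expr0.
  by move: uP; rewrite PE => /and4P[-> _ _ ->].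
rewrite (big_tupleS m (fun w => all (mem P) w && path <=%O u w)
             (fun w => 'X^(\sum_(z <- w) shifted_rank z))) /=.
rewrite [RHS]big_mkcond /=; apply: eq_bigr => z _.
have -> : in_box (cell_row u) (cell_col u) z = (z \in P) && (u <= z)%O.
  move: uP; rewrite !PE /Order.le /= /ferrers_le /in_box => /and4P[h1 h2 h3 h4].
  by apply/idP/idP; lia.
case: ifP => [/andP[zP uz]|nz].
  rewrite -IH // big_distrr /=; apply: eq_big => [w|w _].
    by rewrite zP uz.
  by rewrite big_cons exprD.
by rewrite big_pred0 // => w; move: nz; case: (z \in P) => //= ->; rewrite andbF.
Qed.

Lemma qzeta_coef_chain_sum (P : {set ferrers r b}) rho i c m :
  (forall z, (z \in P) = in_box i c z) -> rho =1 shifted_rank ->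
  (j <= i)%N -> (c <= d)%N -> qzeta_coef P rho m = chain_sum m i c.
Proof.
move=> PE rhoE ji cd.
rewrite /qzeta_coef /is_chain.
under eq_bigr do rewrite -(big_tuple _ _ _ xpredT rho).
under eq_bigr do rewrite (eq_bigr _ (fun z _ => rhoE z)).
case: m => [|m].
  rewrite (big_tuple0 (fun w => all (mem P) w && sorted <=%O w)
             (fun w => 'X^(\sum_(z <- w) shifted_rank z))) /= big_nil expr0.
  by rewrite ji cd.
rewrite (big_tupleS m (fun w => all (mem P) w && sorted <=%O w)
             (fun w => 'X^(\sum_(z <- w) shifted_rank z))) /=.
rewrite [RHS]big_mkcond /=; apply: eq_bigr => z _; rewrite -PE.
case: ifP => zP; last by rewrite big_pred0.
rewrite -(chain_sum_path _ PE) // big_distrr /=; apply: eq_bigr => w _.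
by rewrite big_cons exprD.
Qed.

(** A chain starts at [z] or at another cell of its box; the other cells form the union of the boxes
    at [(i-1, c)] and [(i, c+1)], which meet in the box at [(i-1, c+1)]. For [m = 0] the term
    [z == y] takes over where all smaller boxes are out of range. *)
Lemma chain_sum_rec z m : in_box r 0 z ->
  let i := cell_row z in let c := cell_col z in
  chain_sum m i c =
  (if m is m'.+1 then 'X^(shifted_rank z) * chain_sum m' i c else (z == y)%:R)
  + (chain_sum m i.-1 c +
     (if (c < b i)%N then chain_sum m i c.+1 - chain_sum m i.-1 c.+1 else 0)).
Proof.
move=> zbox i c.
have [i0 ir ic cb] := cellP z; have [j0 jr jd db] := cellP y.
rewrite -/i -/c in i0 ir ic cb; rewrite -/j -/d in j0 jr jd db.
have /and4P[ji _ _ cd] := zbox; rewrite -/i -/c in ji cd.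
have zE u : (u == z) = (cell_row u == i) && (cell_col u == c).
  by apply/eqP/andP => [->|[/eqP h1 /eqP h2]]; [rewrite !eqxx|apply: cell_inj].
case: m => [|m].
  rewrite /= eq_sym zE -/j -/d ji cd.
  case: ifP => cbi; last first.
    (* Here [c = b i]: if [j = i] then [d <= b j = c], hence [z = y]. *)
    have -> : (j == i) && (d == c) = ~~ (j <= i.-1)%N.
      by have := db; have [->|nij] := eqVneq j i; lia.
    by case: (j <= i.-1)%N; rewrite /= ?mulr0n !addr0 ?add0r.
  have -> : (j == i) = ~~ (j <= i.-1)%N by lia.
  have -> : (d == c) = ~~ (c < d)%N by lia.
  case: (j <= i.-1)%N; case: (c < d)%N;
    by rewrite /= ?mulr0n ?subrr ?subr0 ?addr0 ?add0r ?subr0.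
rewrite /= (bigD1 z) /=; last by rewrite /in_box -/i -/c ji cd !leqnn.
congr (_ + _); case: ifP => cbi.
  rewrite addrA -[X in _ - X](_ : \sum_(u | in_box i.-1 c u && in_box i c.+1 u)
     'X^(shifted_rank u) * chain_sum m (cell_row u) (cell_col u) = _).
    rewrite -sum_orb; apply: eq_bigl => u; rewrite zE /in_box.
    by have [u0 ur uc ub] := cellP u; apply/idP/idP; lia.
  by apply: eq_bigl => u; rewrite /in_box; apply/idP/idP; lia.
(* For [c = b i], row [i] has no cell to the right of [z]. *)
rewrite addr0; apply: eq_bigl => u; rewrite zE /in_box.
have [u0 ur uc ub] := cellP u.
have [ui|ui] := eqVneq (cell_row u) i; last by apply/idP/idP; lia.
by rewrite ui in ub *; apply/idP/idP; lia.
Qed.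

Definition chain_poly n i c : {poly {poly int}} :=
  \poly_(m < n.+1) chain_sum m i c.

Lemma chain_poly_out n i c : (i < j)%N || (d < c)%N -> chain_poly n i c = 0.
Proof.
move=> out; apply/polyP => m; rewrite coef_poly coef0.
by rewrite chain_sum_out // if_same.
Qed.

Lemma chain_poly_rec n z : in_box r 0 z ->
  let i := cell_row z in let c := cell_col z in
  exists e : {poly {poly int}}, (1 - weight (shifted_rank z)) * chain_poly n i c =
  (z == y)%:R + (chain_poly n i.-1 c +
     (if (c < b i)%N then chain_poly n i c.+1 - chain_poly n i.-1 c.+1 else 0))
  + e * 'X^(n.+1).
Proof.
(* Multiplying by [weight] pushes the coefficient of degree [n] to degree [n+1], beyond the
   truncation. *)
move=> zbox i c; exists (- ('X^(shifted_rank z) * chain_sum n i c)%:P).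
have wE : weight (shifted_rank z) = 'X * ('X^(shifted_rank z))%:P.
  by rewrite /weight /tvar /qvar polyC_exp.
apply/polyP => m; rewrite wE mulrBl mul1r -mulrA coefB coefXM coefCM.
rewrite -polyCN !coefD coefCM coefXn -polyC_natr coefC.
have -> : (if (c < b i)%N then chain_poly n i c.+1 - chain_poly n i.-1 c.+1
    else 0)`_m = if (c < b i)%N then
      (chain_poly n i c.+1)`_m - (chain_poly n i.-1 c.+1)`_m else 0.
  by case: ifP => _; rewrite ?coefB ?coef0.
rewrite !coef_poly; have := chain_sum_rec m zbox; rewrite -/i -/c.
case: m => [|m] /= ->; first by rewrite mulr0 addr0 subr0.
rewrite !ltnS eqSS; case: (ltngtP m n) => [mn|mn|->].
- by rewrite mulr0 addr0 add0r addrAC subrr add0r.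
- by rewrite !mulr0 subrr if_same !addr0.
- by rewrite mulr1 subrr if_same !add0r.
Qed.

Variable (H : nat).
Hypothesis dE : d = (j + k0 + H)%N.

Definition tail_denominator a : {poly {poly int}} :=
  \prod_(a <= e < H.+1) (1 - weight e).

Lemma tail_denominatorS a : (a <= H)%N ->
  tail_denominator a = (1 - weight a) * tail_denominator a.+1.
Proof. by move=> aH; rewrite /tail_denominator big_ltn. Qed.

(** Strong induction on the number [h] of letters, since the diagonal term drops it by two. The
    bound on [c] is asked only when [j <= i]: row [i-1] may leave the range where [b] is controlled,
    and both sides then vanish. *)
Lemma chain_poly_path_sum n h i c a :
  (a + h)%N = H -> c = (i + k0 + a)%N -> (i <= r)%N ->
  ((j <= i)%N -> (c <= b i)%N) ->
  exists e : {poly {poly int}}, tail_denominator a * chain_poly n i c =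
    path_sum b weight j d stepL a i c h + e * 'X^(n.+1).
Proof.
have [h0] := ubnP h; elim: h0 h i c a => // h0 IH h i c a hh aH cE ir cb.
have [ij|ji] := ltnP i j.
  by exists 0; rewrite chain_poly_out ?ij // path_sum_row_lt // mulr0 mul0r addr0.
have [dc|cd] := ltnP d c.
  exists 0; rewrite chain_poly_out ?dc ?orbT // path_sum_col_gt //.
  by rewrite mulr0 mul0r addr0.
have {}cb := cb ji.
have [j0 jr jd db] := cellP y; rewrite -/j -/d in j0 jr jd db.
have i0 : (0 < i)%N := leq_trans j0 ji.
have [z [zi zc]] : exists z : ferrers r b, cell_row z = i /\ cell_col z = c.
  by apply: ex_cell => //; rewrite cE -addnA leq_addr.
have zbox : in_box r 0 z by rewrite /in_box zi zc ji ir cd.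
have za : shifted_rank z = a.
  by rewrite /shifted_rank /ferrers_rank zi zc cE; lia.
have := chain_poly_rec n zbox; rewrite /= za zi zc => -[e Ge].
have Dz : tail_denominator a * chain_poly n i c = tail_denominator a.+1 *
    ((1 - weight a) * chain_poly n i c).
  by rewrite tail_denominatorS; [ring|lia].
rewrite Dz {Dz} Ge.
case: h hh aH => [|h] hh aH.
  have zy : z == y by apply/eqP/cell_inj; rewrite ?zi ?zc -/j -/d; lia.
  have D1 : tail_denominator a.+1 = 1.
    by rewrite /tail_denominator big_geq //; lia.
  exists e; rewrite path_sum0 zy D1 mul1r.
  have -> : [&& i == j, c == d & (c <= b i)%N].
    by rewrite cb; apply/and3P; split=> //; lia.
  by rewrite !chain_poly_out ?subrr ?if_same ?addr0 //; lia.
have zNy : (z == y) = false.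
  by apply/eqP => zy; move: zi zc; rewrite zy -/j -/d; lia.
rewrite path_sum_rec // zNy mulr0n.
have [|||||e1 E1] := IH h i.-1 c a.+1; try lia.
  move=> ji1; apply: leq_trans cb _; apply: b_noninc; lia.
case: ifP => cbi; last first.
  by exists (e1 + tail_denominator a.+1 * e); rewrite add0r addr0 mulrDr E1; ring.
have [|||||e2 E2] := IH h i c.+1 a.+1; try lia.
(* With no letter left after one step, the corner [(i-1, c+1)] is out of range, matching the zero in
   [path_sum_rec]. *)
case: h => [|h] in hh aH E1 E2 *.
  rewrite [chain_poly n i.-1 c.+1]chain_poly_out; last lia.
  exists (e1 + e2 + tail_denominator a.+1 * e).
  rewrite add0r !subr0 mulr0 subr0 !mulrDr E1 E2; ring.
have [|||||e3 E3] := IH h i.-1 c.+1 a.+2; try lia.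
  move=> ji1; apply: leq_trans cbi _; apply: b_noninc; lia.
exists (e1 + e2 - (1 - weight a.+1) * e3 + tail_denominator a.+1 * e).
rewrite add0r !mulrDr mulrN E1 E2 {1}tail_denominatorS; last lia.
rewrite -[X in - X]mulrA E3; ring.
Qed.

End Chains.

(** * Specialization of the descent enumerators *)

Lemma specialize_sum_prod n (v : 'I_n -> {poly {poly int}}) (I : finType)
    (P : pred I) (D : I -> {set 'I_n}) :
  specialize v (\sum_(w | P w) \prod_(k in D w) 'X_k) =
  \sum_(w | P w) \prod_(k in D w) v k.
Proof.
rewrite /specialize rmorph_sum; apply: eq_bigr => w _.
by rewrite rmorph_prod; apply: eq_bigr => k _ /=; rewrite mmapX mmap1U.
Qed.

Lemma mcoeff_sum_prod_ge0 n (I : finType) (P : pred I) (D : I -> {set 'I_n})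
    (m : 'X_{1..n}) :
  0 <= (\sum_(w | P w) \prod_(k in D w) 'X_k : {mpoly int[n]})@_m.
Proof.
rewrite raddf_sum /=; apply: sumr_ge0 => w _.
rewrite -(big_morph _ (@mpolyXD n int) (mpolyX0 _ _)) mcoeffX.
by case: (_ == m).
Qed.

(** The fictitious preceding L keeps index 0 from being a descent; a descent at an R of index [p] is
    charged to the following L, of index [p+1], whence the exponent. *)
Lemma specialize_local_enum r b (x y : ferrers r b) :
  (x < y)%O ->
  specialize (fun p => tvar * qvar ^+ p.+1) (local_enum x y) =
  path_sum b weight (cell_row y) (cell_col y) stepL 0 (cell_row x) (cell_col x)
    (interval_length x y).
Proof.
move=> xy; have := xy; rewrite lt_neqAle => /andP[xNy].
rewrite /Order.le /= /ferrers_le => /andP[yx xc].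
rewrite /local_enum specialize_sum_prod /path_sum.
have h0 : (0 < interval_length x y)%N.
  rewrite lt0n; apply: contra xNy; rewrite /interval_length => h0.
  by apply/eqP/cell_inj; lia.
apply: eq_big => [w|w _].
  rewrite inE /path_ok; congr [&& _, _ & _]; apply/eqP/eqP; lia.
rewrite descent_weightE size_tuple big_mkcond.
rewrite [RHS]big_mkcond big_ltn // big_add1 /= mul1r -subn1 big_mkord.
apply: eq_bigr => p _; rewrite inE /=; congr (if _ && (_ == _) then _ else _).
by apply: set_nth_default; rewrite size_tuple; have := ltn_ord p; lia.
Qed.

(** A global word is a path from the diagonal cell [(i, i)], with [i = iota_word w], to [(1, b 1)];
    its length then fixes the number of letters R. *)
Lemma specialize_global_enum r b : (0 < r)%N -> (0 < b 1)%N ->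
  specialize (fun j => tvar * qvar ^+ j) (global_enum r b) =
  \sum_(1 <= i < r.+1) path_sum b weight 1 (b 1) stepR 0 i i (word_length b).
Proof.
move=> r0 b0; rewrite /global_enum specialize_sum_prod /path_sum.
under [RHS]eq_bigr do rewrite big_mkcond.
rewrite exchange_big big_mkcond /=; apply: eq_bigr => w _.
have szw : (count_mem stepL w + count_mem stepR w)%N = (b 1%N - 1)%N.
  have <- : size w = (b 1%N - 1)%N by rewrite size_tuple.
  rewrite -(count_predC (pred1 stepL)); congr addn.
  by apply: eq_count; case.
transitivity (\sum_(1 <= i < r.+1 | i == iota_word w)
  if prefix_ok b i i w then descent_weight weight stepR 0 w else 0); last first.
  rewrite big_mkcond; apply: eq_bigr => i _; rewrite /path_ok addn1.
  rewrite -/(iota_word w) [iota_word w == i]eq_sym.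
  have [->|//] := eqVneq i (iota_word w).
  by have -> : (iota_word w + count_mem stepR w == b 1)%N
    by rewrite /iota_word; lia.
rewrite big_nat1_eq inE -/(iota_word w) /iota_word /= ltnS.
have -> : (count_mem stepL w <= r - 1)%N = (count_mem stepL w < r)%N by lia.
case: (_ < _)%N => //=; case: ifP => // _.
rewrite descent_weightE size_tuple big_mkord.
apply: eq_big => [k|//]; rewrite inE andbC (tnth_nth stepL); congr (_ && _).
by case: k => [[|k] hk].
Qed.

(** * From truncated identities to numerators *)

Section Numerators.
Variables (r : nat) (b : nat -> nat).
Hypothesis b_noninc : forall i j : nat, (1 <= i)%N -> (i <= j)%N ->
  (j <= r)%N -> (b j <= b i)%N.
Variable (y : ferrers r b).

(** As [y] has the maximal rank [H], the denominator is [tail_denominator H 0]. The coefficient of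
    degree [n] sees only chains of length at most [n], so truncation there is harmless. *)
Lemma qzeta_numeratorP k0 (P : {set ferrers r b}) rho H i c N :
  (forall z, (z \in P) = in_box y i c z) -> rho =1 shifted_rank k0 ->
  y \in P -> (forall z, z \in P -> (rho z <= H)%N) -> rho y = H ->
  (forall n, exists e, tail_denominator H 0 * chain_poly y k0 n i c =
     N + e * 'X^(n.+1)) ->
  is_qzeta_numerator P rho N.
Proof.
move=> PE rhoE yP leH yH HN n; have [e He] := HN n.
have := yP; rewrite PE => /and4P[_ ji cd _].
have mH : max_rank P rho = H.
  apply/eqP; rewrite eqn_leq; apply/andP; split; first exact/bigmax_leqP.
  by rewrite -yH; apply: leq_bigmax_cond.
have -> : qzeta_denominator P rho = tail_denominator H 0.
  rewrite /qzeta_denominator mH /tail_denominator big_mkord.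
  by apply: eq_bigr => a _; rewrite /weight mulrC.
have -> : N = tail_denominator H 0 * chain_poly y k0 n i c - e * 'X^(n.+1).
  by rewrite He addrK.
rewrite coefB coefMXn ltnSn subr0 coefM; apply: eq_bigr => k _.
rewrite coef_poly ltnS leq_subr.
by rewrite (qzeta_coef_chain_sum _ PE rhoE).
Qed.

(** Columns are at least rows, so row [k] lies in the box at [(k, k)]; together with the box at
    [(k-1, 0)] it covers the box at [(k, 0)]. *)
Lemma chain_poly_row k0 n k : (k <= cell_col y)%N ->
  chain_poly y k0 n k 0 = chain_poly y k0 n k.-1 0 + chain_poly y k0 n k k
    - chain_poly y k0 n k.-1 k.
Proof.
move=> kd; apply/polyP => m; rewrite coefB coefD !coef_poly.
case: ifP => _; last by rewrite subr0 addr0.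
case: m => [|m] /=; first by rewrite kd !andbT [in RHS]addrC addKr.
rewrite -[X in _ - X](_ : \sum_(u | in_box y k.-1 0 u && in_box y k k u)
   'X^(shifted_rank k0 u) * chain_sum y k0 m (cell_row u) (cell_col u) = _).
  rewrite -sum_orb; apply: eq_bigl => u; rewrite /in_box.
  by have [u0 ur uc ub] := cellP u; apply/idP/idP; lia.
by apply: eq_bigl => u; rewrite /in_box; apply/idP/idP; lia.
Qed.

Hypothesis b_ge : forall i : nat, (1 <= i)%N -> (i <= r)%N -> (i <= b i)%N.

(** Row [i] adds the series of [(i, i)] minus that of [(i-1, i)]. The latter has rank 1, so a factor
    [1 - weight 0] remains and [path_sum_prevR] yields the words preceded by R. *)
Lemma chain_poly_total n k H : cell_col y = (cell_row y + H)%N ->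
  (k <= r)%N -> (k <= cell_col y)%N ->
  exists e, tail_denominator H 0 * chain_poly y 0 n k 0 =
    \sum_(1 <= i < k.+1)
      path_sum b weight (cell_row y) (cell_col y) stepR 0 i i H
    + e * 'X^(n.+1).
Proof.
move=> dE; have [j0 jr jd db] := cellP y.
have dE' : cell_col y = (cell_row y + 0 + H)%N by rewrite addn0.
elim: k => [|k IH] kr kd.
  by exists 0; rewrite chain_poly_out ?j0 // big_nil // mulr0 mul0r addr0.
have [||e1 E1] := IH; try lia.
rewrite chain_poly_row // big_nat_recr //=.
rewrite path_sum_prevR //; last exact: b_ge.
have [||||e2 E2] := chain_poly_path_sum b_noninc dE' n
  (h := H) (i := k.+1) (c := k.+1) (a := 0%N); try lia.
  by move=> _; apply: b_ge.
(* If [H = 0] then [k < cell_row y], and the box at [(k, k+1)] is out of range. *)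
case: H => [|H] in dE dE' IH E1 E2 *.
  exists (e1 + e2); rewrite [chain_poly _ _ _ k k.+1]chain_poly_out; last lia.
  by rewrite mulr0 subr0 addr0 mulrDr E1 E2; ring.
have [||||e3 E3] := chain_poly_path_sum b_noninc dE' n
  (h := H) (i := k) (c := k.+1) (a := 1%N); try lia.
  move=> jk; apply: leq_trans (b_ge _ kr) _ => //; apply: b_noninc; lia.
exists (e1 + e2 - (1 - weight 0) * e3).
rewrite mulrBr mulrDr E1 E2 tail_denominatorS // -mulrA E3; ring.
Qed.

End Numerators.

Theorem proposition5p2 (r : nat) (b : nat -> nat)
    (r_ge1 : (1 <= r)%N)
    (b_noninc : forall i j : nat, (1 <= i)%N -> (i <= j)%N -> (j <= r)%N ->
       (b j <= b i)%N)
    (b_ge : forall i : nat, (1 <= i)%N -> (i <= r)%N -> (i <= b i)%N) :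
  [/\ (forall m : 'X_{1..word_length b}, 0 <= (global_enum r b)@_m),
      is_qzeta_numerator [set: ferrers r b] (@ferrers_rank r b)
        (specialize (fun j => tvar * qvar ^+ j) (global_enum r b))
    & forall x y : ferrers r b, (x < y)%O ->
        is_qzeta_numerator (ferrers_interval x y) (local_rank x)
          (specialize (fun p => tvar * qvar ^+ p.+1) (local_enum x y))].
Proof.
split=> [m||x y xy]; first exact: mcoeff_sum_prod_ge0.
  have b1 : (0 < b 1)%N by exact: b_ge.
  (* This cell is the maximum, and its box with corner [(r, 0)] is the whole poset. *)
  have [y [yr yc]] : exists y : ferrers r b, cell_row y = 1%N
      /\ cell_col y = b 1%N by apply: ex_cell.
  rewrite specialize_global_enum //.
  apply: (@qzeta_numeratorP _ _ y 0%N _ _ (word_length b) r 0) => [z|z||z _||n].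
  - rewrite inE /in_box yr yc; have [z0 zr zc zb] := cellP z.
    by rewrite z0 zr (leq_trans zb) // b_noninc.
  - by rewrite /shifted_rank subn0.
  - by rewrite inE.
  - have [z0 zr zc zb] := cellP z; have := b_noninc 1%N _ (leqnn 1) z0 zr.
    by rewrite /ferrers_rank /word_length; lia.
  - by rewrite /ferrers_rank yr yc.
  - have [|||e He] := chain_poly_total b_noninc b_ge n (y := y)
      (k := r) (H := word_length b); rewrite ?yr ?yc /word_length //; try lia.
      exact: leq_trans (b_ge r r_ge1 (leqnn r)) (b_noninc _ _ _ r_ge1 _).
    by rewrite yr yc in He; exists e.
have := ltW xy; rewrite /Order.le /= /ferrers_le => /andP[ryx cxy].
have [x0 xr xc xb] := cellP x; have [y0 yr yc yb] := cellP y.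
rewrite specialize_local_enum //.
(* Shifting by the rank of [x] gives [x] rank 0 and [y] the interval length as rank. *)
apply: (@qzeta_numeratorP _ _ y (ferrers_rank x) _ _ (interval_length x y)
  (cell_row x) (cell_col x)) => [z|//||z||n].
- by rewrite inE /Order.le /= /ferrers_le /in_box; apply/idP/idP; lia.
- by rewrite inE lexx ltW.
- rewrite inE /Order.le /= /ferrers_le /local_rank /ferrers_rank.
  by rewrite /interval_length; lia.
- by rewrite /local_rank /ferrers_rank /interval_length; lia.
- by apply: chain_poly_path_sum; rewrite /interval_length /ferrers_rank //; lia.
Qed.
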